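(* The pair of functors $\mathcal{M}:\mathbf{CSRng}\to\mathbf{ACMnd}$, $S\mapsto M_S$, and $\mathcal{E}:\mathbf{ACMnd}\to\mathbf{CSRng}$, $T\mapsto T(1)$, forms an adjunction $\mathcal{M}\dashv\mathcal{E}$.
   Context: $\mathbf{CSRng}$: commutative semirings $(S,+,0,\cdot,1)$ in sets, i.e. two commutative monoid structures with $s\cdot0=0$ and $s\cdot(t+r)=s\cdot t+s\cdot r$, with structure-preserving maps. $\mathbf{ACMnd}$: monads on $\mathbf{Sets}$ that are additive and commutative, with monad maps. Each monad $T$ on $\mathbf{Sets}$ has strength $\mathsf{st}:T(X)\times Y\to T(X\times Y)$, $\mathsf{st}(u,y)=T(\lambda x.(x,y))(u)$; let $\mathsf{st}'=T(\gamma)\circ\mathsf{st}\circ\gamma$ with $\gamma$ the swap. $T$ is commutative if $\mu\circ T(\mathsf{st}')\circ\mathsf{st}=\mu\circ T(\mathsf{st})\circ\mathsf{st}'$. If $T(0)\cong1$, let $0_{X,Y}=(X\to1\cong T(0)\xrightarrow{T(!)}T(Y))$, $p_1=[\eta,0_{Y,X}]$, $p_2=[0_{X,Y},\eta]$ and $\mathsf{bc}=\langle\mu\circ T(p_1),\mu\circ T(p_2)\rangle:T(X+Y)\to T(X)\times T(Y)$. $T$ is additive if $T(0)\cong1$ and all $\mathsf{bc}$ are isomorphisms. Functor $\mathcal{M}$: $M_S(X)=\{\varphi:X\to S\mid\varphi(x)\neq0\text{ for only finitely many }x\}$, whose elements are written as finite formal sums $\sum_is_ix_i$; $M_S(f)(\sum_is_ix_i)=\sum_is_if(x_i)$;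 unit $x\mapsto1x$; multiplication $\sum_is_i\varphi_i\mapsto\lambda x.\sum_is_i\varphi_i(x)$. A semiring map $f:S\to R$ is sent to the monad map $\sum_is_ix_i\mapsto\sum_if(s_i)x_i$. Functor $\mathcal{E}$: $T(1)$ is a commutative semiring with addition $T(\nabla)\circ\mathsf{bc}^{-1}:T(1)\times T(1)\to T(1)$ (where $\nabla=[\mathrm{id},\mathrm{id}]$), zero $0_{1,1}:1\to T(1)$, multiplication $\mu\circ T(\pi_2)\circ\mathsf{st}:T(1)\times T(1)\to T(1)$ and unit $\eta_1:1\to T(1)$. A monad map $\sigma$ is sent to $\sigma_1$. *)

(* Defs.v *)
From HB Require Import structures.
From mathcomp Require Import all_boot all_algebra finmap boolp.

Set Implicit Arguments.
Unset Strict Implicit.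
Unset Printing Implicit Defensive.

Import GRing.Theory.

Local Open Scope ring_scope.
#[local] Obligation Tactic := idtac.

Record category := Category {
  ob :> Type;
  hom : ob -> ob -> Type;
  idm : forall X, hom X X;
  comp : forall X Y Z, hom Y Z -> hom X Y -> hom X Z;
  comp_idl : forall X Y (f : hom X Y), comp (idm Y) f = f;
  comp_idr : forall X Y (f : hom X Y), comp f (idm X) = f;
  comp_assoc : forall X Y Z W (f : hom Z W) (g : hom Y Z) (h : hom X Y),
    comp f (comp g h) = comp (comp f g) h
}.

Record functor (C D : category) := Functor {
  fob :> C -> D;
  fmor : forall X Y : C, hom X Y -> hom (fob X) (fob Y);
  fmor_id : forall X, fmor (idm X) = idm (fob X);
  fmor_comp : forall X Y Z (f : hom Y Z) (g : hom X Y),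
    fmor (comp f g) = comp (fmor f) (fmor g)
}.

Record adjunction (C D : category) (F : functor C D) (G : functor D C) :=
  Adjunction {
  adj : forall (X : C) (Y : D), hom (F X) Y -> hom X (G Y);
  adj_bij : forall X Y, bijective (@adj X Y);
  adj_natl : forall (X X' : C) (Y : D) (f : hom X' X) (u : hom (F X) Y),
    adj (comp u (fmor F f)) = comp (adj u) f;
  adj_natr : forall (X : C) (Y Y' : D) (g : hom Y Y') (u : hom (F X) Y),
    adj (comp g u) = comp (fmor G g) (adj u)
}.

Definition left_adjoint (C D : category) (F : functor C D) (G : functor D C)
  : Prop := inhabited (adjunction F G).

Notation "F ⊣ G" := (left_adjoint F G) (at level 70).

Definition isomorphic (X Y : Type) : Prop := exists f : X -> Y, bijective f.

Lemma bijective_inv (X Y : Type) (f : X -> Y) :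
  bijective f -> exists2 g : Y -> X, cancel f g & cancel g f.
Proof. by case=> g; exists g. Qed.

Definition inv_bij (X Y : Type) (f : X -> Y) (bij_f : bijective f) : Y -> X :=
  s2val (cid2 (bijective_inv bij_f)).

Lemma inv_bijK (X Y : Type) (f : X -> Y) (h : bijective f) :
  cancel f (inv_bij h).
Proof. by rewrite /inv_bij; case: cid2. Qed.

Lemma inv_bijKV (X Y : Type) (f : X -> Y) (h : bijective f) :
  cancel (inv_bij h) f.
Proof. by rewrite /inv_bij; case: cid2. Qed.

Definition copair (X Y Z : Type) (f : X -> Z) (g : Y -> Z) (u : X + Y) : Z :=
  match u with inl x => f x | inr y => g y end.

Definition swap (X Y : Type) (p : X * Y) : Y * X := (p.2, p.1).

(* Monads on the category of sets, taken to be Type with functions.           *)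
Record monad := Monad {
  mob :> Type -> Type;
  mmap : forall X Y, (X -> Y) -> mob X -> mob Y;
  munit : forall X, X -> mob X;
  mmul : forall X, mob (mob X) -> mob X;
  mmap_id : forall X (u : mob X), mmap id u = u;
  mmap_comp : forall X Y Z (g : Y -> Z) (f : X -> Y) (u : mob X),
    mmap (g \o f) u = mmap g (mmap f u);
  munit_nat : forall X Y (f : X -> Y) (x : X), mmap f (munit x) = munit (f x);
  mmul_nat : forall X Y (f : X -> Y) (u : mob (mob X)),
    mmap f (mmul u) = mmul (mmap (mmap f) u);
  mmul_unit : forall X (u : mob X), mmul (munit u) = u;
  mmul_map_unit : forall X (u : mob X), mmul (mmap (@munit X) u) = u;
  mmul_assoc : forall X (u : mob (mob (mob X))),
    mmul (mmap (@mmul X) u) = mmul (mmul u)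
}.
Arguments munit {m X} x.
Arguments mmul {m X} u.
Arguments mmap {m X Y} f u.

Record monad_map (T T' : monad) := MonadMap {
  mm_fun :> forall X, T X -> T' X;
  mm_nat : forall X Y (f : X -> Y) (u : T X),
    mm_fun (mmap f u) = mmap f (mm_fun u);
  mm_unit : forall X (x : X), mm_fun (munit x) = munit x;
  mm_mul : forall X (u : T (T X)),
    mm_fun (mmul u) = mmul (mm_fun (mmap (@mm_fun X) u))
}.

Section MonadStructure.
Variable T : monad.

Definition st (X Y : Type) (p : T X * Y) : T (X * Y)%type :=
  mmap (fun x => (x, p.2)) p.1.

Definition st' (X Y : Type) : X * T Y -> T (X * Y)%type :=
  mmap (@swap Y X) \o @st Y X \o @swap X (T Y).

Definition commutative_monad : Prop := forall X Y : Type,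
  mmul \o mmap (@st' X Y) \o @st X (T Y)
    =1 mmul \o mmap (@st X Y) \o @st' (T X) Y.

Section Zero.
Hypothesis T0 : isomorphic (T void) unit.

(* An isomorphism T 0 ~ 1 is unique, so the choice of a witness is immaterial. *)
Definition T0_inv : unit -> T void := inv_bij (projT2 (cid T0)).

Definition zero_map (X Y : Type) : X -> T Y :=
  mmap (@of_void Y) \o T0_inv \o (fun=> tt).

Definition p1 (X Y : Type) : X + Y -> T X := copair munit (@zero_map Y X).
Definition p2 (X Y : Type) : X + Y -> T Y := copair (@zero_map X Y) munit.

Definition bc (X Y : Type) (u : T (X + Y)%type) : T X * T Y :=
  (mmul (mmap (@p1 X Y) u), mmul (mmap (@p2 X Y) u)).
End Zero.

Definition additive_monad : Prop :=
  exists T0 : isomorphic (T void) unit,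
    forall X Y : Type, bijective (@bc T0 X Y).

End MonadStructure.

Record acmonad := ACMonad {
  ac_monad :> monad;
  ac_additive : additive_monad ac_monad;
  ac_commutative : commutative_monad ac_monad
}.

Lemma monad_mapP (T T' : monad) (s t : monad_map T T') :
  (forall X, s X =1 t X) -> s = t.
Proof.
case: s => s s1 s2 s3; case: t => t t1 t2 t3 /= st.
have e : s = t by apply: functional_extensionality_dep => X; apply/funext/st.
case: t / e t1 t2 t3 {st} => t1 t2 t3.
by congr MonadMap; apply: Prop_irrelevance.
Qed.

Program Definition monad_map_id (T : monad) : monad_map T T :=
  @MonadMap T T (fun X => id) _ _ _.
Next Obligation. by []. Qed.
Next Obligation. by []. Qed.
Next Obligation. by move=> T X u; rewrite /= mmap_id. Qed.

Program Definition monad_map_comp (T T' T'' : monad)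
    (t : monad_map T' T'') (s : monad_map T T') : monad_map T T'' :=
  @MonadMap T T'' (fun X => t X \o s X) _ _ _.
Next Obligation. by move=> T T' T'' t s X Y f u /=; rewrite !mm_nat. Qed.
Next Obligation. by move=> T T' T'' t s X x /=; rewrite !mm_unit. Qed.
Next Obligation.
by move=> T T' T'' t s X u /=; rewrite !mm_mul !mm_nat mmap_comp.
Qed.

Program Definition ACMnd : category :=
  @Category acmonad (fun T T' => monad_map T T') (fun T => monad_map_id T)
    (fun _ _ _ t s => monad_map_comp t s) _ _ _.
Next Obligation. by move=> T T' s; apply: monad_mapP. Qed.
Next Obligation. by move=> T T' s; apply: monad_mapP. Qed.
Next Obligation. by move=> *; apply: monad_mapP. Qed.

Lemma rmorphP (S R : comPzSemiRingType) (f g : {rmorphism S -> R}) :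
  f =1 g -> f = g.
Proof.
case: f => f [[f1] [f2]]; case: g => g [[g1] [g2]] /= /funext fg.
case: g / fg g1 g2 => g1 g2.
by rewrite (Prop_irrelevance f1 g1) (Prop_irrelevance f2 g2).
Qed.

(* comPzSemiRingType does not require 1 != 0. It includes a choice operator,  *)
(* which every set has classically and which morphisms ignore.                *)
Program Definition CSRng : category :=
  @Category comPzSemiRingType (fun S R => {rmorphism S -> R})
    (fun S => idfun : {rmorphism S -> S})
    (fun S R Q f g => (f \o g : {rmorphism S -> Q})) _ _ _.
Next Obligation. by move=> *; apply: rmorphP. Qed.
Next Obligation. by move=> *; apply: rmorphP. Qed.
Next Obligation. by move=> *; apply: rmorphP. Qed.

Section MultisetMonad.
Variable S : comPzSemiRingType.

(* {classic X} is X itself, equipped with classical decidable equality.       *)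
Definition MS (X : Type) : Type := {fsfun {classic X} -> S with 0}.

Definition MS_map (X Y : Type) (f : X -> Y) (phi : MS X) : MS Y :=
  [fsfun y in [fset (f x : {classic Y}) | x : {classic X} in finsupp phi]%fset
     => \sum_(x <- finsupp phi | (f x : {classic Y}) == y) phi x].

Definition MS_unit (X : Type) (x : X) : MS X :=
  [fsfun y in [fset (x : {classic X})]%fset => 1].

Definition MS_mul (X : Type) (Phi : MS (MS X)) : MS X :=
  [fsfun x in (\bigcup_(phi <- finsupp Phi) finsupp (phi : MS X))%fset
     => \sum_(phi <- finsupp Phi) Phi phi * (phi : MS X) x].

(* The S-linear extension of h, evaluated at the formal sum phi.              *)
Definition MS_eval (X : Type) (phi : MS X) (h : X -> S) : S :=
  \sum_(x <- finsupp phi) phi x * h x.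

Lemma MS_evalE (X : Type) (phi : MS X) (A : {fset {classic X}}) (h : X -> S) :
  (finsupp phi `<=` A)%fset -> MS_eval phi h = \sum_(x <- A) phi x * h x.
Proof.
move=> sA; apply: big_fset_incl => // x _ xN.
by rewrite fsfun_dflt ?mul0r.
Qed.

Lemma MS_evalP (X : Type) (phi psi : MS X) :
  (forall h, MS_eval phi h = MS_eval psi h) -> phi = psi.
Proof.
have E (u : MS X) (x : {classic X}) :
    u x = MS_eval u (fun y => ((y : {classic X}) == x)%:R).
  rewrite (@MS_evalE _ _ (finsupp u `|` [fset x])%fset) ?fsubsetUl //.
  rewrite (big_fsetD1 x) /= ?inE ?eqxx ?orbT // mulr1.
  rewrite big_seq big1 ?addr0 // => y.
  by rewrite !inE => /andP[/negPf -> _]; rewrite mulr0.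
by move=> e; apply/fsfunP => x; rewrite !E e.
Qed.

Lemma MS_eval_map (X Y : Type) (f : X -> Y) (phi : MS X) (h : Y -> S) :
  MS_eval (MS_map f phi) h = MS_eval phi (h \o f).
Proof.
set A := [fset (f x : {classic Y}) | x : {classic X} in finsupp phi]%fset.
rewrite (@MS_evalE _ _ A); last first.
  apply/fsubsetP => y; rewrite mem_finsupp fsfunE.
  by case: ifP => //; rewrite eqxx.
transitivity (\sum_(y <- A)
    \sum_(x <- finsupp phi | (f x : {classic Y}) == y) phi x * h (f x)).
  rewrite [LHS]big_seq [RHS]big_seq; apply: eq_bigr => y yA.
  by rewrite fsfunE yA big_distrl; apply: eq_bigr => x /eqP <-.
rewrite (exchange_big_dep xpredT) //= /MS_eval.
rewrite [LHS]big_seq [RHS]big_seq; apply: eq_bigr => x xphi.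
rewrite big_fset_condE /= (_ : [fset _ | _ in _ & _]%fset
   = [fset (f x : {classic Y})]%fset) ?big_seq_fset1 //.
apply/fsetP => y; rewrite !inE /= eq_sym andb_idl // => /eqP ->.
exact: in_imfset.
Qed.

Lemma MS_eval_unit (X : Type) (x : X) (h : X -> S) :
  MS_eval (MS_unit x) h = h x.
Proof.
rewrite (@MS_evalE _ _ [fset (x : {classic X})]%fset) ?big_seq_fset1.
  by rewrite fsfunE inE eqxx mul1r.
apply/fsubsetP => y; rewrite mem_finsupp fsfunE.
by case: ifP => //; rewrite eqxx.
Qed.

Lemma MS_eval_mul (X : Type) (Phi : MS (MS X)) (h : X -> S) :
  MS_eval (MS_mul Phi) h = MS_eval Phi (fun phi => MS_eval phi h).
Proof.
set A := (\bigcup_(phi <- finsupp Phi) finsupp (phi : MS X))%fset.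
rewrite (@MS_evalE _ _ A); last first.
  apply/fsubsetP => y; rewrite mem_finsupp fsfunE.
  by case: ifP => //; rewrite eqxx.
rewrite big_seq; under eq_bigr => y yA do rewrite fsfunE yA big_distrl /=.
rewrite -big_seq exchange_big /= /MS_eval.
rewrite [LHS]big_seq [RHS]big_seq; apply: eq_bigr => phi phiP.
have sA : (finsupp (phi : MS X) `<=` A)%fset by exact: bigfcup_sup.
rewrite -/(MS_eval _ h) (MS_evalE _ sA) big_distrr /=.
by apply: eq_bigr => x _; rewrite mulrA.
Qed.

Definition MS_evalS := (MS_eval_map, MS_eval_unit, MS_eval_mul).

Lemma MS_eval_ext (X : Type) (phi : MS X) (h k : X -> S) :
  h =1 k -> MS_eval phi h = MS_eval phi k.
Proof. by move=> hk; congr MS_eval; apply/funext. Qed.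

Program Definition MS_monad : monad :=
  @Monad MS MS_map MS_unit MS_mul _ _ _ _ _ _ _.
Next Obligation. by move=> X u; apply: MS_evalP => h; rewrite !MS_evalS. Qed.
Next Obligation.
by move=> X Y Z g f u; apply: MS_evalP => h; rewrite /= !MS_evalS.
Qed.
Next Obligation.
by move=> X Y f x; apply: MS_evalP => h; rewrite /= !MS_evalS.
Qed.
Next Obligation.
move=> X Y f u; apply: MS_evalP => h; rewrite /= !MS_evalS.
by apply: MS_eval_ext => v /=; rewrite MS_evalS.
Qed.
Next Obligation. by move=> X u; apply: MS_evalP => h; rewrite /= !MS_evalS. Qed.
Next Obligation.
move=> X u; apply: MS_evalP => h; rewrite /= !MS_evalS.
by apply: MS_eval_ext => v /=; rewrite MS_evalS.
Qed.
Next Obligation.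
move=> X u; apply: MS_evalP => h; rewrite /= !MS_evalS.
by apply: MS_eval_ext => v /=; rewrite MS_evalS.
Qed.

Lemma MS_commutative : commutative_monad MS_monad.
Proof.
move=> X Y [u v]; apply: MS_evalP => h; rewrite /= /st' /= !MS_evalS /=.
transitivity (MS_eval u (fun x => MS_eval v (fun y => h (x, y)))).
  apply: MS_eval_ext => x /=; rewrite /st /= !MS_evalS.
  exact: MS_eval_ext.
transitivity (MS_eval v (fun y => MS_eval u (fun x => h (x, y)))); last first.
  by apply: MS_eval_ext => y /=; rewrite /st /= !MS_evalS; apply: MS_eval_ext.
rewrite /MS_eval; under eq_bigr do rewrite big_distrr /=.
rewrite exchange_big /=; apply: eq_bigr => y _.
by rewrite big_distrr /=; apply: eq_bigr => x _; rewrite mulrCA.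
Qed.

Lemma MS_eval0 (X : Type) (phi : MS X) : MS_eval phi (fun=> 0) = 0.
Proof. by rewrite /MS_eval big1 // => x _; rewrite mulr0. Qed.

Lemma MS0_uniq (u v : MS void) : u = v.
Proof. by apply: MS_evalP => h; rewrite /MS_eval !big1 // => -[]. Qed.

Lemma MS_eval_void (u : MS void) h : MS_eval u h = 0.
Proof. by rewrite /MS_eval big1 // => -[]. Qed.

Lemma MS_T0 : isomorphic (MS_monad void) unit.
Proof.
exists (fun=> tt); exists (fun=> [fsfun]) => [u|[]] //; exact: MS0_uniq.
Qed.

Lemma MS_additive : additive_monad MS_monad.
Proof.
exists MS_T0 => X Y.
have bc1 (w : MS (X + Y)%type) h :
    MS_eval (bc MS_T0 w).1 h = MS_eval w (copair h (fun=> 0)).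
  rewrite /= !MS_evalS; apply: MS_eval_ext => -[x|y] /=; rewrite !MS_evalS //.
  exact: MS_eval_void.
have bc2 (w : MS (X + Y)%type) h :
    MS_eval (bc MS_T0 w).2 h = MS_eval w (copair (fun=> 0) h).
  rewrite /= !MS_evalS; apply: MS_eval_ext => -[x|y] /=; rewrite !MS_evalS //.
  exact: MS_eval_void.
have split (w : MS (X + Y)%type) h : MS_eval w h =
    MS_eval w (copair (h \o inl) (fun=> 0))
      + MS_eval w (copair (fun=> 0) (h \o inr)).
  rewrite /MS_eval -big_split /=; apply: eq_bigr => -[x|y] _ /=.
    by rewrite mulr0 addr0.
  by rewrite mulr0 add0r.
pose pairing (p : MS X * MS Y) : MS (X + Y)%type :=
  [fsfun z in ([fset (inl x : {classic X + Y}) | x : {classic X} in finsupp p.1]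
               `|` [fset (inr x : {classic X + Y}) | x : {classic Y} in finsupp p.2])%fset
     => copair p.1 p.2 z].
have pairE p z : pairing p z = copair p.1 p.2 z.
  rewrite fsfunE; case: ifPn => //; rewrite !inE negb_or => /andP[z1 z2].
  case: z z1 z2 => [x|y] z1 z2 /=; rewrite fsfun_dflt //.
    by apply: contra z1 => xp; apply/imfsetP; exists x.
  by apply: contra z2 => xp; apply/imfsetP; exists y.
have pair_eval p h : MS_eval (pairing p) h
    = MS_eval p.1 (h \o inl) + MS_eval p.2 (h \o inr).
  set A := [fset (inl x : {classic X + Y}) | x : {classic X} in finsupp p.1]%fset.
  set B := [fset (inr x : {classic X + Y}) | x : {classic Y} in finsupp p.2]%fset.
  rewrite (@MS_evalE _ _ (A `|` B)%fset); last first.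
    apply/fsubsetP => z; rewrite mem_finsupp fsfunE.
    by case: ifP => //; rewrite eqxx.
  have /(perm_big _) -> : perm_eq (A `|` B)%fset ((A : seq _) ++ B).
    apply: uniq_perm => [||z]; rewrite ?fset_uniq //.
      rewrite cat_uniq !fset_uniq andbT; apply/hasPn => z /imfsetP[y _ ->].
      by apply/negP => /imfsetP[x _].
    by rewrite mem_cat inE.
  rewrite big_cat.
  congr (_ + _); rewrite big_imfset /=.
  - by apply: eq_bigr => x _; rewrite pairE.
  - by move=> ? ? _ _ [].
  - by apply: eq_bigr => x _; rewrite pairE.
  - by move=> ? ? _ _ [].
exists pairing => [w|[u v]].
  by apply: MS_evalP => h; rewrite pair_eval bc1 bc2 -split.
apply: injective_projections;
  apply: MS_evalP => h; rewrite ?bc1 ?bc2 pair_eval /=.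
- by rewrite (MS_eval0 v : MS_eval v (copair h _ \o inr) = 0) addr0.
- by rewrite (MS_eval0 u : MS_eval u (copair _ h \o inl) = 0) add0r.
Qed.

Definition MS_acmonad : acmonad := ACMonad MS_additive MS_commutative.

End MultisetMonad.

Definition MS_change (S R : comPzSemiRingType) (f : {rmorphism S -> R})
    (X : Type) (phi : MS S X) : MS R X :=
  [fsfun x in finsupp phi => f (phi x)].

Lemma MS_changeE (S R : comPzSemiRingType) (f : {rmorphism S -> R})
  (X : Type) (phi : MS S X) (x : {classic X}) : MS_change f phi x = f (phi x).
Proof.
rewrite fsfunE; case: ifPn => // xN.
by rewrite [phi x]fsfun_dflt // rmorph0.
Qed.

Lemma MS_mapE (S : comPzSemiRingType) (X Y : Type) (f : X -> Y) (phi : MS S X)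
    (y : {classic Y}) :
  MS_map f phi y = MS_eval phi (fun x => ((f x : {classic Y}) == y)%:R).
Proof.
rewrite fsfunE /MS_eval; case: ifPn => yA.
  by rewrite big_mkcond; apply: eq_bigr => x _; rewrite mulr_natr mulrb.
rewrite big_seq big1 // => x xphi; case: eqP => [e|]; last by rewrite mulr0.
by case/negP: yA; apply/imfsetP; exists x.
Qed.

Lemma MS_mulE (S : comPzSemiRingType) (X : Type) (Phi : MS S (MS S X))
    (x : {classic X}) :
  MS_mul Phi x = MS_eval Phi (fun phi => phi x).
Proof.
rewrite fsfunE /MS_eval; case: ifPn => // xA.
rewrite big_seq big1 // => phi phiP.
rewrite [X in _ * X]fsfun_dflt ?mulr0 //; apply: contra xA => xphi.
by apply/bigfcupP; exists phi => //; rewrite phiP.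
Qed.

Lemma MS_unitE (S : comPzSemiRingType) (X : Type) (x y : X) :
  MS_unit S x y = ((y : {classic X}) == x)%:R.
Proof. by rewrite fsfunE inE; case: ifP. Qed.

Lemma MS_eval_change (S R : comPzSemiRingType) (f : {rmorphism S -> R})
    (X : Type) (phi : MS S X) (h : X -> S) :
  MS_eval (MS_change f phi) (f \o h) = f (MS_eval phi h).
Proof.
rewrite (@MS_evalE _ _ _ (finsupp phi)).
  by rewrite rmorph_sum; apply: eq_bigr => x _; rewrite MS_changeE rmorphM.
apply/fsubsetP => x; rewrite !mem_finsupp MS_changeE.
by apply: contra_neq => ->; rewrite rmorph0.
Qed.

Program Definition MS_monad_map (S R : comPzSemiRingType)
    (f : {rmorphism S -> R}) : monad_map (MS_monad S) (MS_monad R) :=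
  @MonadMap (MS_monad S) (MS_monad R) (MS_change f) _ _ _.
Next Obligation.
move=> S R f X Y g u; apply/fsfunP => y.
rewrite MS_changeE /= !MS_mapE -MS_eval_change.
by apply: MS_eval_ext => x /=; rewrite rmorph_nat.
Qed.
Next Obligation.
move=> S R f X x; apply/fsfunP => y.
by rewrite MS_changeE /= !MS_unitE rmorph_nat.
Qed.
Next Obligation.
move=> S R f X u; apply/fsfunP => x.
rewrite MS_changeE /= !MS_mulE -MS_eval_change.
transitivity (MS_eval (MS_map (@MS_change _ _ f X) (MS_change f u))
               (fun phi => phi x)).
  by rewrite MS_eval_map; apply: MS_eval_ext => v /=; rewrite MS_changeE.
congr MS_eval; apply/fsfunP => psi.
rewrite MS_changeE !MS_mapE -MS_eval_change.
by apply: MS_eval_ext => v /=; rewrite rmorph_nat.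
Qed.

Program Definition functorM : functor CSRng ACMnd :=
  @Functor CSRng ACMnd MS_acmonad (fun S R f => MS_monad_map f) _ _.
Next Obligation.
move=> S; apply: monad_mapP => X phi; apply/fsfunP => x.
exact: MS_changeE.
Qed.
Next Obligation.
move=> S R Q f g; apply: monad_mapP => X phi; apply/fsfunP => x.
by rewrite /= !MS_changeE.
Qed.

Section ScalarSemiring.
Variable T : acmonad.

Definition ac_T0 : isomorphic (T void) unit := projT1 (cid (ac_additive T)).

Definition ac_bc_bij (X Y : Type) : bijective (@bc T ac_T0 X Y) :=
  projT2 (cid (ac_additive T)) X Y.

Definition scalars : Type := T unit.

HB.instance Definition _ := gen_eqMixin scalars.
HB.instance Definition _ := gen_choiceMixin scalars.

Definition scalar_add (a b : scalars) : scalars :=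
  mmap (copair id id) (inv_bij (@ac_bc_bij unit unit) (a, b)).

Definition scalar_zero : scalars := zero_map ac_T0 unit tt.

Definition scalar_mul (a b : scalars) : scalars :=
  mmul (mmap (fun p => p.2) (st (a, b))).

Definition scalar_one : scalars := munit tt.

Definition mbind (X Y : Type) (k : X -> T Y) (u : T X) : T Y := mmul (mmap k u).

Lemma mbindA (X Y Z : Type) (k : Y -> T Z) (l : X -> T Y) u :
  mbind k (mbind l u) = mbind (fun x => mbind k (l x)) u.
Proof.
rewrite /mbind mmul_nat -mmul_assoc -!mmap_comp; congr mmul.
Qed.

Lemma mbind_unit (X Y : Type) (k : X -> T Y) x : mbind k (munit x) = k x.
Proof. by rewrite /mbind munit_nat mmul_unit. Qed.

Lemma mbindE (X Y : Type) (f : X -> Y) (u : T X) :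
  mmap f u = mbind (fun x => munit (f x)) u.
Proof. by rewrite /mbind (mmap_comp (@munit T Y) f) mmul_map_unit. Qed.

Lemma mbind_id (X : Type) (k : X -> T X) u : k =1 munit -> mbind k u = u.
Proof. by move=> /funext ->; rewrite /mbind mmul_map_unit. Qed.

Lemma eq_bind (X Y : Type) (k l : X -> T Y) u : k =1 l -> mbind k u = mbind l u.
Proof. by move=> /funext ->. Qed.

Lemma T0_eq (u v : T void) : u = v.
Proof. by case: ac_T0 => f /bij_inj; apply; case: (f u); case: (f v). Qed.

Definition mzero (X : Type) : T X := zero_map ac_T0 X tt.

Lemma mbind_zero (X Y : Type) (k : X -> T Y) : mbind k (mzero X) = mzero Y.
Proof.
rewrite /mzero /zero_map /= !mbindE mbindA; set u := T0_inv _ _.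
by apply: eq_bind => -[].
Qed.

Lemma mbind_to_zero (X Y : Type) (u : T X) : mbind (fun=> mzero Y) u = mzero Y.
Proof.
rewrite [in RHS]/mzero /zero_map /= mbindE.
rewrite (T0_eq (T0_inv _ _) (mbind (fun=> T0_inv ac_T0 tt) u)) mbindA.
by apply: eq_bind => x; rewrite /mzero /zero_map /= mbindE.
Qed.

Definition bc_inv (X Y : Type) (a : T X) (b : T Y) : T (X + Y)%type :=
  inv_bij (@ac_bc_bij X Y) (a, b).

Lemma bc_invl (X Y : Type) (a : T X) (b : T Y) :
  mbind (@p1 T ac_T0 X Y) (bc_inv a b) = a.
Proof. by have /(congr1 fst) := inv_bijKV (@ac_bc_bij X Y) (a, b). Qed.

Lemma bc_invr (X Y : Type) (a : T X) (b : T Y) :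
  mbind (@p2 T ac_T0 X Y) (bc_inv a b) = b.
Proof. by have /(congr1 snd) := inv_bijKV (@ac_bc_bij X Y) (a, b). Qed.

Lemma bc_inj (X Y : Type) (u v : T (X + Y)%type) :
  mbind (@p1 T ac_T0 X Y) u = mbind (@p1 T ac_T0 X Y) v ->
  mbind (@p2 T ac_T0 X Y) u = mbind (@p2 T ac_T0 X Y) v -> u = v.
Proof.
by move=> e1 e2; apply: (bij_inj (@ac_bc_bij X Y)); rewrite /bc; congr pair.
Qed.

Lemma scalar_addE (a b : scalars) (w : T (unit + unit)%type) :
  mmul (mmap (@p1 T ac_T0 unit unit) w) = a ->
  mmul (mmap (@p2 T ac_T0 unit unit) w) = b ->
  scalar_add a b = mmap (copair id id) w.
Proof.
move=> e1 e2; congr mmap; apply: bc_inj; rewrite (bc_invl, bc_invr).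
  by rewrite -e1.
by rewrite -e2.
Qed.

Lemma scalar_mulE (a b : scalars) : scalar_mul a b = mmul (mmap (fun=> b) a).
Proof. by rewrite /scalar_mul /st -mmap_comp. Qed.

Lemma scalar_addC : commutative scalar_add.
Proof.
move=> a b; pose s (u : unit + unit) := copair inr inl u : unit + unit.
have e : mmap (copair id id) (bc_inv a b) =
         mmap (copair id id) (mmap s (bc_inv a b)).
  by rewrite -mmap_comp; congr mmap; apply/funext => -[].
rewrite /scalar_add -/(bc_inv a b) e; apply/esym/scalar_addE;
  rewrite -/(mbind _ _) mbindE mbindA.
- rewrite -[RHS](bc_invr a b); apply: eq_bind => -[] x /=;
  by rewrite mbind_unit.
- rewrite -[RHS](bc_invl a b); apply: eq_bind => -[] x /=;
  by rewrite mbind_unit.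
Qed.

Lemma scalar_add0 : left_id scalar_zero scalar_add.
Proof.
move=> a; rewrite (@scalar_addE _ _ (mmap inr a)) -?/(mbind _ _).
- by rewrite -mmap_comp (_ : _ \o _ = id) ?mmap_id //; apply/funext.
- rewrite mbindE mbindA -[RHS](mbind_to_zero unit a).
  by apply: eq_bind => x; rewrite mbind_unit.
- by rewrite mbindE mbindA; apply: mbind_id => x; rewrite mbind_unit.
Qed.

Lemma scalar_addA : associative scalar_add.
Proof.
move=> a b c.
pose w := bc_inv a (bc_inv b c).
pose i1 : unit + (unit + unit) -> unit + unit :=
  copair inl (fun=> inr tt).
pose i2 : unit + (unit + unit) -> unit + unit :=
  copair (fun=> inl tt) (copair (fun=> inl tt) inr).
have ea : mbind (copair munit (fun=> mzero unit)) w = a.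
  exact: (bc_invl a (bc_inv b c)).
have ew : mbind (copair (fun=> mzero (unit + unit)) munit) w = bc_inv b c.
  exact: (bc_invr a (bc_inv b c)).
have eb : mbind (copair (fun=> mzero unit) (copair munit (fun=> mzero unit))) w
    = b.
  rewrite -[RHS](bc_invl b c) -ew mbindA; apply: eq_bind => -[x|[x|x]] /=;
  by rewrite ?mbind_unit ?mbind_zero.
have ec : mbind (copair (fun=> mzero unit) (copair (fun=> mzero unit) munit)) w
    = c.
  rewrite -[RHS](bc_invr b c) -ew mbindA; apply: eq_bind => -[x|[x|x]] /=;
  by rewrite ?mbind_unit ?mbind_zero.
pose j : unit + (unit + unit) -> T (unit + unit)%type :=
  copair (fun=> munit (inl tt))
    (copair (fun=> munit (inr tt)) (fun=> mzero (unit + unit))).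
have ebc : scalar_add b c = mbind (copair (fun=> mzero unit) (fun=> munit tt)) w.
  rewrite /scalar_add -/(bc_inv b c) -ew mbindE mbindA.
  apply: eq_bind => -[[]|[[]|[]]] /=; by rewrite ?mbind_unit ?mbind_zero.
have eab : scalar_add a b = mbind (copair (fun=> munit tt)
     (copair (fun=> munit tt) (fun=> mzero unit))) w.
  rewrite (@scalar_addE _ _ (mbind j w)) -?/(mbind _ _).
  - rewrite mbindE mbindA; apply: eq_bind => -[[]|[[]|[]]] /=;
    by rewrite ?mbind_unit ?mbind_zero.
  - rewrite -[RHS]ea mbindA; apply: eq_bind => -[[]|[[]|[]]] /=;
    by rewrite ?mbind_unit ?mbind_zero.
  - rewrite -[RHS]eb mbindA; apply: eq_bind => -[[]|[[]|[]]] /=;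
    by rewrite ?mbind_unit ?mbind_zero.
rewrite (@scalar_addE _ _ (mmap i1 w)) -?/(mbind _ _); first last.
- rewrite ebc mbindE mbindA; apply: eq_bind => -[[]|[[]|[]]] /=;
  by rewrite ?mbind_unit.
- rewrite -[RHS]ea mbindE mbindA; apply: eq_bind => -[[]|[[]|[]]] /=;
  by rewrite ?mbind_unit.
rewrite (@scalar_addE (scalar_add a b) c (mmap i2 w)) -?/(mbind _ _).
- by rewrite -!mmap_comp; congr mmap; apply/funext => -[[]|[[]|[]]].
- rewrite eab mbindE mbindA; apply: eq_bind => -[[]|[[]|[]]] /=;
  by rewrite ?mbind_unit.
- rewrite -[RHS]ec mbindE mbindA; apply: eq_bind => -[[]|[[]|[]]] /=;
  by rewrite ?mbind_unit.
Qed.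

HB.instance Definition _ :=
  GRing.isNmodule.Build scalars scalar_addA scalar_addC scalar_add0.

Lemma scalar_mulA : associative scalar_mul.
Proof. by move=> a b c; rewrite !scalar_mulE -!/(mbind _ _) mbindA. Qed.

Lemma scalar_mulC : commutative scalar_mul.
Proof.
move=> a b; have := @ac_commutative T unit unit (a, b).
move=> /(congr1 (mmap (fun=> tt))).
rewrite /= /st' /st /= -!mmap_comp -!/(mbind _ _) !mbindE !mbindA => e.
rewrite !scalar_mulE -!/(mbind _ _); move: e.
rewrite (@eq_bind _ _ _ (fun=> b)); last first.
  move=> x; rewrite /= !mbindE !mbindA; apply: mbind_id => y.
  by rewrite !mbind_unit; case: y.
move=> ->; apply: eq_bind => x; rewrite /= !mbindE mbindA.
by apply: mbind_id => -[]; rewrite !mbind_unit.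
Qed.

Lemma scalar_mul1 : left_id scalar_one scalar_mul.
Proof. by move=> a; rewrite scalar_mulE -/(mbind _ _) mbind_unit. Qed.

Lemma scalar_mul0 : left_zero scalar_zero scalar_mul.
Proof. by move=> a; rewrite scalar_mulE -/(mbind _ _) mbind_zero. Qed.

Lemma scalar_mulDl : left_distributive scalar_mul scalar_add.
Proof.
move=> b c a; rewrite [LHS]scalar_mulE -/(mbind _ _).
rewrite {1}/scalar_add -/(bc_inv b c) mbindE mbindA.
pose u := mbind (fun i => mmap (fun=> i) a) (bc_inv b c).
rewrite (@scalar_addE _ _ u) -?/(mbind _ _).
- rewrite mbindE mbindA; apply: eq_bind => i.
  rewrite mbind_unit !mbindE !mbindA; apply/esym/mbind_id => -[].
  by rewrite !mbind_unit; case: (copair _ _ _).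
- rewrite scalar_mulE -/(mbind _ _) -[in RHS](bc_invl b c) !mbindA.
  apply: eq_bind => -[[]|[]];
    rewrite !mbindE !mbindA /= ?mbind_unit ?mbind_zero.
    by apply: mbind_id => -[]; rewrite ?mbind_unit.
  by rewrite (@eq_bind _ _ _ (fun=> mzero unit)) ?mbind_to_zero // => x;
    rewrite ?mbind_unit.
- rewrite scalar_mulE -/(mbind _ _) -[in RHS](bc_invr b c) !mbindA.
  apply: eq_bind => -[[]|[]];
    rewrite !mbindE !mbindA /= ?mbind_unit ?mbind_zero.
    by rewrite (@eq_bind _ _ _ (fun=> mzero unit)) ?mbind_to_zero // => x;
      rewrite ?mbind_unit.
  by apply: mbind_id => -[]; rewrite ?mbind_unit.
Qed.

HB.instance Definition _ := GRing.Nmodule_isComPzSemiRing.Build scalars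
  scalar_mulA scalar_mulC scalar_mul1 scalar_mulDl scalar_mul0.

End ScalarSemiring.

Section ScalarMorphism.
Variables (T T' : acmonad) (s : monad_map T T').

Definition scalar_map : scalars T -> scalars T' := s unit.

Lemma mm_zero (X Y : Type) (x : X) :
  s Y (zero_map (ac_T0 T) Y x) = zero_map (ac_T0 T') Y x.
Proof.
by rewrite /zero_map /= mm_nat; congr mmap; exact: T0_eq.
Qed.

Lemma scalar_map_nmod : nmod_morphism scalar_map.
Proof.
split; first exact: mm_zero.
move=> a b; rewrite -[LHS]/(s unit (scalar_add a b)) mm_nat.
set w := inv_bij _ _; have := inv_bijKV (@ac_bc_bij T unit unit) (a, b).
rewrite -/w /bc => -[e1 e2]; apply/esym/scalar_addE.
- rewrite -e1 /scalar_map mm_mul !mm_nat -mmap_comp; congr (mmul (mmap _ _)).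
  by apply/funext => -[x|x] /=; rewrite ?mm_unit ?mm_zero.
- rewrite -e2 /scalar_map mm_mul !mm_nat -mmap_comp; congr (mmul (mmap _ _)).
  by apply/funext => -[x|x] /=; rewrite ?mm_unit ?mm_zero.
Qed.

Lemma scalar_map_monoid : monoid_morphism scalar_map.
Proof.
split; first exact: mm_unit.
move=> a b; rewrite -[LHS]/(s unit (scalar_mul a b)).
rewrite -[RHS]/(scalar_mul (s unit a) (s unit b)) !scalar_mulE mm_mul !mm_nat.
by rewrite -mmap_comp.
Qed.

HB.instance Definition _ := GRing.isNmodMorphism.Build
  (scalars T) (scalars T') scalar_map scalar_map_nmod.
HB.instance Definition _ := GRing.isMonoidMorphism.Build
  (scalars T) (scalars T') scalar_map scalar_map_monoid.

End ScalarMorphism.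

Program Definition functorE : functor ACMnd CSRng :=
  @Functor ACMnd CSRng (fun T : acmonad => scalars T : comPzSemiRingType)
    (fun T T' s => scalar_map s : {rmorphism scalars T -> scalars T'}) _ _.
Next Obligation. by move=> *; apply: rmorphP. Qed.
Next Obligation. by move=> *; apply: rmorphP. Qed.

(* Main.v *)
(* For an additive commutative monad T every T X is a module over the semiring
   T 1: scalars act by a . u = a >>= (fun _ => u), and u + v is obtained by
   binding the element of T (1 + 1) with components (1, 1) along [u, v].
   Additivity gives the monoid laws, commutativity of T the distributivity of
   the action over sums. Kleisli extensions and monad maps preserve these linear
   combinations. As M_S X consists of the formal linear combinations of elements
   of X, a semiring map f : S -> T 1 extends uniquely to the monad map
   sum_i s_i x_i |-> sum_i f(s_i) . eta(x_i); it is recovered by restricting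
   along S ~ M_S 1. *)
From HB Require Import structures.
From mathcomp Require Import all_boot all_algebra finmap boolp.
Require Import Defs.

Set Implicit Arguments.
Unset Strict Implicit.
Unset Printing Implicit Defensive.

Import GRing.Theory.

Local Open Scope ring_scope.

(** Commutativity at [(u, v)], followed by the Kleisli extension of the uncurried [k]; binding along
    [st] or [st'] merely fixes one coordinate. *)
Lemma mbindC (T : acmonad) (X Y Z : Type) (k : X -> Y -> T Z) (u : T X)
    (v : T Y) :
  mbind (fun x => mbind (k x) v) u = mbind (fun y => mbind (k^~ y) u) v.
Proof.
have stE (A B C : Type) (F : A * B -> T C) (a : T A) (b : B) :
    mbind F (st (a, b)) = mbind (fun x => F (x, b)) a.
  rewrite /st /= mbindE mbindA.
  by apply: eq_bind => x; rewrite mbind_unit.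
have st'E (A B C : Type) (F : A * B -> T C) (a : A) (b : T B) :
    mbind F (st' (a, b)) = mbind (fun y => F (a, y)) b.
  rewrite /st' /= mbindE mbindA stE.
  by apply: eq_bind => x; rewrite mbind_unit.
have := @ac_commutative T X Y (u, v).
move=> /(congr1 (mbind (fun p : X * Y => k p.1 p.2))).
rewrite /= -!/(mbind _ _) !mbindA stE st'E => e.
transitivity
    (mbind (fun x => mbind (fun p : X * Y => k p.1 p.2) (st' (x, v))) u).
  by apply: eq_bind => x; rewrite st'E.
by rewrite e; apply: eq_bind => y; rewrite stE.
Qed.

(** * The module structure of T X over the semiring T 1 *)

Section ScalarModule.
Variable T : acmonad.

Definition tpair : T (unit + unit)%type := bc_inv (munit tt) (munit tt).

Lemma tpair_unique (w : T (unit + unit)%type) :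
  mbind (@p1 T (ac_T0 T) unit unit) w = munit tt ->
  mbind (@p2 T (ac_T0 T) unit unit) w = munit tt -> w = tpair.
Proof. by move=> e1 e2; apply: bc_inj; rewrite (bc_invl, bc_invr). Qed.

Lemma tpairr (X : Type) (u : T X) :
  mbind (copair (fun=> mzero T X) (fun=> u)) tpair = u.
Proof.
rewrite -[RHS](mbind_unit (fun=> u) tt) -[munit tt](bc_invr (munit tt)).
by rewrite mbindA; apply: eq_bind => -[x|x] /=; rewrite ?mbind_unit ?mbind_zero.
Qed.

Section Carrier.
Variable X : Type.

Definition tmod : Type := T X.
HB.instance Definition _ := gen_eqMixin tmod.
HB.instance Definition _ := gen_choiceMixin tmod.

Definition tadd (u v : tmod) : tmod :=
  mbind (copair (fun=> u) (fun=> v)) tpair.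

Definition tscale (a : scalars T) (u : tmod) : tmod := mbind (fun=> u) a.

Lemma tadd0 : left_id (mzero T X : tmod) tadd.
Proof. exact: tpairr. Qed.

Lemma taddC : commutative tadd.
Proof.
move=> u v; pose s (i : unit + unit) : unit + unit := copair inr inl i.
(* Swapping the summands exchanges the two components of [tpair], and these are equal. *)
have e : mmap s tpair = tpair.
  by apply: tpair_unique; rewrite mbindE mbindA;
    [rewrite -[RHS](bc_invr (munit tt)) | rewrite -[RHS](bc_invl _ (munit tt))];
    apply: eq_bind => -[x|x]; rewrite mbind_unit.
rewrite /tadd -{1}e mbindE mbindA.
by apply: eq_bind => -[x|x]; rewrite mbind_unit.
Qed.

End Carrier.

Lemma mbind_tadd (X Y : Type) (k : X -> T Y) (u v : tmod X) :
  mbind k (tadd u v) = tadd (mbind k u) (mbind k v).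
Proof. by rewrite /tadd mbindA; apply: eq_bind => -[]. Qed.

Lemma mbind_tscale (X Y : Type) (k : X -> T Y) a (u : tmod X) :
  mbind k (tscale a u) = tscale a (mbind k u).
Proof. by rewrite /tscale mbindA. Qed.

(** The first projection keeps the [inl] summand and sends the other to zero; the second does the
    reverse. This ties the inverse of [bc], which defines addition on T 1, to [tadd]. *)
Lemma tadd_bc (X Y : Type) (a : T X) (b : T Y) :
  bc_inv a b = tadd (mmap inl a) (mmap inr b).
Proof.
apply: bc_inj; rewrite (bc_invl, bc_invr) mbind_tadd !mbindE !mbindA.
  rewrite [X in tadd X _]mbind_id => [|x]; last by rewrite mbind_unit.
  rewrite (@eq_bind _ _ _ _ (fun=> mzero T X)) => [|x]; last first.
    by rewrite mbind_unit.
  by rewrite mbind_to_zero taddC tadd0.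
rewrite [X in tadd _ X]mbind_id => [|x]; last by rewrite mbind_unit.
rewrite (@eq_bind _ _ _ _ (fun=> mzero T Y)) => [|x]; last first.
  by rewrite mbind_unit.
by rewrite mbind_to_zero tadd0.
Qed.

Lemma scalar_add_tadd (a b : scalars T) : scalar_add a b = tadd a b.
Proof.
rewrite /scalar_add -/(bc_inv a b) tadd_bc mbindE mbind_tadd !mbindE !mbindA.
by rewrite !mbind_id // => -[]; rewrite mbind_unit.
Qed.

Section Carrier.
Variable X : Type.

(* Both sides are the image of a sum in T (1 + (1 + 1)), for which
   associativity can be checked on components. *)
Lemma taddA : associative (@tadd X).
Proof.
move=> u v x.
pose c3 : unit + (unit + unit) -> T X :=
  copair (fun=> u) (copair (fun=> v) (fun=> x)).
pose e1 : T (unit + (unit + unit))%type := munit (inl tt).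
pose e2 : T (unit + (unit + unit))%type := munit (inr (inl tt)).
pose e3 : T (unit + (unit + unit))%type := munit (inr (inr tt)).
have -> : tadd u (tadd v x) = mbind c3 (tadd e1 (tadd e2 e3)).
  by rewrite !mbind_tadd !mbind_unit.
have -> : tadd (tadd u v) x = mbind c3 (tadd (tadd e1 e2) e3).
  by rewrite !mbind_tadd !mbind_unit.
congr mbind.
apply: bc_inj; rewrite !mbind_tadd !mbind_unit /=.
  by rewrite -/(mzero T unit) tadd0 [tadd _ (mzero _ _)]taddC tadd0
     [tadd _ (mzero _ _)]taddC tadd0.
by rewrite -/(mzero T _) !tadd0.
Qed.

HB.instance Definition _ :=
  GRing.isNmodule.Build (tmod X) taddA (@taddC X) (@tadd0 X).

Lemma tscaleA (a b : scalars T) (u : tmod X) :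
  tscale a (tscale b u) = tscale (a * b) u.
Proof.
rewrite -[a * b]/(scalar_mul a b) scalar_mulE -/(mbind _ _).
by rewrite /tscale mbindA.
Qed.

Lemma tscale0 (u : tmod X) : tscale 0 u = 0.
Proof. exact: mbind_zero. Qed.

Lemma tscale1 : left_id 1 (@tscale X).
Proof. by move=> u; rewrite /tscale mbind_unit. Qed.

Lemma tscaleDr : right_distributive (@tscale X) +%R.
Proof.
(* Commutativity of T exchanges binding over [a] with binding over [tpair]. *)
move=> a u v; rewrite /tscale -[u + v]/(tadd u v) /tadd mbindC.
by apply: eq_bind => -[].
Qed.

(** For fixed [u] the action is the Kleisli extension of a constant map, and Kleisli extensions are
    additive. *)
Lemma tscaleDl (u : tmod X) : {morph (@tscale X)^~ u : a b / a + b}.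
Proof.
move=> a b; rewrite -[a + b]/(scalar_add a b) scalar_add_tadd.
exact: mbind_tadd.
Qed.

HB.instance Definition _ := GRing.Nmodule_isLSemiModule.Build (scalars T)
  (tmod X) tscaleA tscale0 tscale1 tscaleDr tscaleDl.

End Carrier.

Lemma mbind_sum (X Y : Type) (k : X -> T Y) (I : Type) (r : seq I)
    (a : I -> scalars T) (u : I -> tmod X) :
  mbind k (\sum_(i <- r) a i *: u i) =
  \sum_(i <- r) a i *: (mbind k (u i) : tmod Y).
Proof.
elim: r => [|i r IH]; first by rewrite !big_nil; exact: mbind_zero.
by rewrite !big_cons -IH -[RHS]/(tadd (tscale _ _) _) -mbind_tscale -mbind_tadd.
Qed.

End ScalarModule.

Lemma mm_sum (T T' : acmonad) (s : monad_map T T') (X I : Type) (r : seq I)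
    (a : I -> scalars T) (u : I -> tmod T X) :
  s X (\sum_(i <- r) a i *: u i) =
  \sum_(i <- r) scalar_map s (a i) *: (s X (u i) : tmod T' X).
Proof.
have sbind (Y Z : Type) (k : Y -> T Z) w :
    s Z (mbind k w) = mbind (s Z \o k) (s Y w).
  by rewrite /mbind mm_mul -mmap_comp mm_nat.
(* [tpair] is determined by its components, and [s] respects units and zero maps, hence both
   projections. *)
have sw : s _ (tpair T) = tpair T'.
  apply: tpair_unique; rewrite -[RHS](mm_unit s).
    rewrite -[munit tt](bc_invl _ (munit tt)) sbind.
    by apply: eq_bind => -[x|x]; rewrite /= ?mm_unit ?mm_zero.
  rewrite -[munit tt](bc_invr (munit tt)) sbind.
  by apply: eq_bind => -[x|x]; rewrite /= ?mm_unit ?mm_zero.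
elim: r => [|i r IH]; first by rewrite !big_nil; exact: mm_zero.
rewrite !big_cons -IH -[LHS]/(s X (tadd _ _)) /tadd sbind sw.
by apply: eq_bind => -[x|x] //=; rewrite sbind.
Qed.

(** * Extension of a semiring map S -> T 1 to a monad map M_S -> T *)

Section Extension.
Variables (S : comPzSemiRingType) (T : acmonad).
Variable f : {rmorphism S -> scalars T}.

Definition lin (X Y : Type) (phi : MS S X) (k : X -> tmod T Y) : tmod T Y :=
  \sum_(x <- finsupp phi) f (phi x) *: k x.

Lemma linE (X Y : Type) (phi : MS S X) (A : {fset {classic X}})
    (k : X -> tmod T Y) :
  (finsupp phi `<=` A)%fset -> lin phi k = \sum_(x <- A) f (phi x) *: k x.
Proof.
move=> sA; apply: big_fset_incl => // x _ xN.
by rewrite fsfun_dflt // rmorph0 scale0r.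
Qed.

Lemma lin_unit (X Y : Type) (x : X) (k : X -> tmod T Y) :
  lin (MS_unit S x) k = k x.
Proof.
rewrite (@linE _ _ _ [fset (x : {classic X})]%fset) ?big_seq_fset1.
  by rewrite MS_unitE eqxx rmorph1 scale1r.
apply/fsubsetP => y; rewrite mem_finsupp MS_unitE inE.
by case: (y == _) => //; rewrite eqxx.
Qed.

(** Over the union [B] of the supports the left side becomes a double sum whose order is exchanged.
    Only the values of [chi] are prescribed, so that the functorial action and the multiplication of
    M_S are both instances. *)
Lemma lin_bind (X Y Z : Type) (phi : MS S X) (psi : X -> MS S Y) (chi : MS S Y)
    (k : Y -> tmod T Z) :
  (forall y : {classic Y}, chi y = MS_eval phi (fun x => psi x y)) ->
  lin chi k = lin phi (fun x => lin (psi x) k).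
Proof.
move=> chiE.
set B := (\bigcup_(x <- finsupp phi) finsupp (psi x))%fset.
rewrite (@linE _ _ chi B); last first.
  apply/fsubsetP => y; rewrite mem_finsupp chiE; apply: contra_neqT => yB.
  rewrite /MS_eval big_seq big1 // => x xphi.
  rewrite [X in _ * X]fsfun_dflt ?mulr0 //; apply: contra yB => yx.
  by apply/bigfcupP; exists x; rewrite ?xphi.
under eq_bigr => y _ do rewrite chiE /MS_eval rmorph_sum scaler_suml.
rewrite exchange_big /= /lin [LHS]big_seq [RHS]big_seq.
apply: eq_bigr => x xphi.
have sB : (finsupp (psi x) `<=` B)%fset by exact: bigfcup_sup.
rewrite -/(lin _ k) (linE _ sB) scaler_sumr.
by apply: eq_bigr => y _; rewrite rmorphM scalerA.
Qed.

Lemma lin_map (X Y Z : Type) (g : X -> Y) (phi : MS S X) (k : Y -> tmod T Z) :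
  lin (MS_map g phi) k = lin phi (k \o g).
Proof.
rewrite (@lin_bind _ _ _ phi (fun x => MS_unit S (g x))) => [|y].
  by congr lin; apply/funext => x; rewrite lin_unit.
by rewrite MS_mapE; apply: MS_eval_ext => x; rewrite MS_unitE eq_sym.
Qed.

Lemma lin_mul (X Y : Type) (Phi : MS S (MS S X)) (k : X -> tmod T Y) :
  lin (MS_mul Phi) k = lin Phi (fun phi => lin phi k).
Proof. by apply: lin_bind => x; rewrite MS_mulE. Qed.

Lemma mbind_lin (X Y Z : Type) (l : Y -> T Z) (phi : MS S X)
    (k : X -> tmod T Y) :
  mbind l (lin phi k) = lin phi (fun x => mbind l (k x) : tmod T Z).
Proof. exact: mbind_sum. Qed.

Definition ext (X : Type) (phi : MS_monad S X) : T X :=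
  lin phi (munit : X -> tmod T X).

Lemma ext_nat (X Y : Type) (g : X -> Y) (phi : MS_monad S X) :
  ext (mmap g phi) = mmap g (ext phi).
Proof.
rewrite /ext lin_map mbindE mbind_lin; congr lin; apply/funext => x.
by rewrite mbind_unit.
Qed.

Lemma ext_unit (X : Type) (x : X) : ext (munit x) = munit x.
Proof. exact: lin_unit. Qed.

Lemma ext_mul (X : Type) (Phi : MS_monad S (MS_monad S X)) :
  ext (mmul Phi) = mmul (ext (mmap (@ext X) Phi)).
Proof.
rewrite ext_nat -/(mbind _ _) mbind_lin /ext lin_mul.
by congr lin; apply/funext => phi; rewrite mbind_unit.
Qed.

Definition ext_map : monad_map (MS_monad S) T :=
  MonadMap ext_nat ext_unit ext_mul.

End Extension.

(** * The unit S -> M_S 1, and formal sums as linear combinations *)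

Section Unit.
Variable S : comPzSemiRingType.
Let M := MS_acmonad S.

Lemma MS_bindE (X Y : Type) (k : X -> M Y) (phi : M X) (y : {classic Y}) :
  (mbind k phi : MS S Y) y = MS_eval phi (fun x => (k x : MS S Y) y).
Proof. by rewrite /mbind /= MS_mulE MS_eval_map. Qed.

Lemma MS_zeroE (X : Type) (x : {classic X}) : (mzero M X : MS S X) x = 0.
Proof. by rewrite /mzero /zero_map /= MS_mapE MS_eval_void. Qed.

(** [tpair] comes from a chosen inverse of [bc] and has no explicit formula. So [h] is split into
    one part per summand, and each part is evaluated through the matching component of [tpair]. *)
Lemma MS_eval_tpair (h : unit + unit -> S) :
  MS_eval (tpair M) h = h (inl tt) + h (inr tt).
Proof.
transitivity (MS_eval (tpair M) (copair (fun=> h (inl tt)) (fun=> 0))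
    + MS_eval (tpair M) (copair (fun=> 0) (fun=> h (inr tt)))).
  rewrite /MS_eval -big_split /=; apply: eq_bigr => -[[]|[]] _ /=.
    by rewrite mulr0 addr0.
  by rewrite mulr0 add0r.
congr (_ + _).
- transitivity
    (MS_eval (mbind (@p1 M (ac_T0 M) unit unit) (tpair M)) (fun=> h (inl tt))).
    rewrite /mbind /= !MS_evalS; apply: MS_eval_ext => -[x|x] /=.
      by rewrite MS_evalS.
    by rewrite /zero_map /= MS_evalS MS_eval_void.
  by rewrite bc_invl MS_eval_unit.
- transitivity
    (MS_eval (mbind (@p2 M (ac_T0 M) unit unit) (tpair M)) (fun=> h (inr tt))).
    rewrite /mbind /= !MS_evalS; apply: MS_eval_ext => -[x|x] /=.
      by rewrite /zero_map /= MS_evalS MS_eval_void.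
    by rewrite MS_evalS.
  by rewrite bc_invr MS_eval_unit.
Qed.

Lemma MS_taddE (X : Type) (phi psi : tmod M X) (x : {classic X}) :
  (tadd phi psi : MS S X) x = (phi : MS S X) x + (psi : MS S X) x.
Proof. by rewrite MS_bindE MS_eval_tpair. Qed.

Definition eta (s : S) : scalars M :=
  [fsfun x in [fset (tt : {classic unit})]%fset => s] : MS S unit.

Lemma etaE s (x : {classic unit}) : (eta s : MS S unit) x = s.
Proof. by case: x; rewrite fsfunE inE eqxx. Qed.

Lemma MS_eval_eta s (h : unit -> S) : MS_eval (eta s) h = s * h tt.
Proof.
rewrite (@MS_evalE _ _ _ [fset (tt : {classic unit})]%fset).
  by rewrite big_seq_fset1 etaE.
by apply/fsubsetP => -[] _; rewrite inE.
Qed.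

Lemma eta_nmod : nmod_morphism eta.
Proof.
split=> [|a b]; apply/fsfunP => x; rewrite etaE.
  exact/esym/MS_zeroE.
rewrite -[eta a + eta b]/(scalar_add (eta a) (eta b)) scalar_add_tadd.
by rewrite MS_taddE !etaE.
Qed.

Lemma eta_monoid : monoid_morphism eta.
Proof.
split=> [|a b]; apply/fsfunP => x; rewrite etaE; first by case: x.
rewrite -[eta a * eta b]/(scalar_mul (eta a) (eta b)) scalar_mulE -/(mbind _ _).
by rewrite MS_bindE MS_eval_eta etaE.
Qed.

HB.instance Definition _ :=
  GRing.isNmodMorphism.Build S (scalars M) eta eta_nmod.
HB.instance Definition _ :=
  GRing.isMonoidMorphism.Build S (scalars M) eta eta_monoid.

(** Since monad maps preserve linear combinations and units, this makes a monad map out of M_S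
    determined by its values on scalars. *)
Lemma MS_decomp (X : Type) (phi : MS S X) :
  phi = \sum_(x <- finsupp phi) eta (phi x) *: (MS_unit S (x : X) : tmod M X).
Proof.
apply/fsfunP => y.
have -> (r : seq {classic X}) :
    (\sum_(x <- r) eta (phi x) *: (MS_unit S (x : X) : tmod M X) : MS S X) y =
    \sum_(x <- r) phi x * (x == y)%:R.
  elim: r => [|x r IH]; first by rewrite !big_nil; exact: MS_zeroE.
  rewrite !big_cons -IH [LHS]MS_taddE; congr (_ + _).
  by rewrite [LHS]MS_bindE MS_eval_eta MS_unitE eq_sym.
(* The identity law writes [phi y] as the evaluation of [phi] against the Kronecker delta at [y]. *)
have e : MS_map id phi = phi := @mmap_id (MS_monad S) X phi.
by rewrite -[in LHS]e MS_mapE.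
Qed.

End Unit.

Theorem lemma27 : functorM ⊣ functorE.
Proof.
(* The transpose restricts the component of [u] at 1 along [eta]. *)
pose adj (S : CSRng) (T : ACMnd) (u : hom (functorM S) T) :
  hom S (functorE T) := scalar_map u \o @eta S : {rmorphism S -> scalars T}.
constructor; apply: (@Adjunction _ _ _ _ adj).
- move=> S T; exists (fun f : {rmorphism S -> scalars T} => ext_map f).
  (* Decomposing [phi] and applying [u] termwise gives the extension of the transpose. *)
  + move=> u; apply: monad_mapP => X phi.
    rewrite [in RHS](MS_decomp phi); apply/esym.
    apply: etrans (@mm_sum (MS_acmonad S) T u _ _ _ _ _) _.
    apply: eq_bigr => x _.
    have -> : u X (MS_unit S (x : X)) = munit (x : X) by exact: mm_unit.
    by [].
  (* The formal sum [eta s] has a single term, so its extension is [f s] acting on the unit of T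
     1. *)
  + move=> f; apply: rmorphP => s; rewrite /= /scalar_map /= /ext.
    rewrite (@linE _ _ _ _ _ _ [fset (tt : {classic unit})]%fset).
      by rewrite big_seq_fset1 etaE; apply: mbind_id; case.
    by apply/fsubsetP => -[] _; rewrite inE.
- move=> S S' T f u; apply: rmorphP => s /=; rewrite /scalar_map /=.
  (* Both arguments of [u] are the formal sum with coefficient [f s] at [tt]. *)
  by congr (u _ _); apply/fsfunP => x; rewrite MS_changeE !etaE.
- by move=> S T T' g u; apply: rmorphP.
Qed.
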